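(* Suppose that a topology $\mathcal{T}$ on $\mathcal{G}=\mathcal{G}_{1,1}$ is asymptotically compatible with germ order. Then $\mathcal{T}$ is not first countable.
   Context: $\mathcal{G}=\mathcal{G}_{1,1}$ is the ring of germs at $0$ of arbitrary functions $f:(\mathbb{R},0)\to(\mathbb{R},0)$ (defined on a neighborhood of $0$, $f(0)=0$). $\widetilde{\mathcal{M}}$ is the set of germs at $0$ of functions $m:\mathbb{R}_+\to\mathbb{R}_+$ ($\mathbb{R}_+=(0,\infty)$) with $0<m(r)\le m(s)$ for small $r<s$ and $\lim_{t\to0}m(t)=0$. $\widetilde{\mathcal{M}}$ is regarded as a subset of $\mathcal{G}_{1,1}$ by extending $m$ evenly, $x\mapsto m(|x|)$ (value $0$ at $0$). For elements of $\widetilde{\mathcal{M}}$, $[m]<[m']$ means $m(t)<m'(t)$ for all sufficiently small $t>0$, and $[m]\le[m']$ is defined similarly. A topology $\mathcal{T}$ on $\mathcal{G}$ is asymptotically compatible with germ order if there is a subset $\mathfrak{X}\subset\widetilde{\mathcal{M}}\subset\mathcal{G}$ that is germwise coinitial in $\widetilde{\mathcal{M}}$ (for every $[m]\in\widetilde{\mathcal{M}}$ there is $[x]\in\mathfrak{X}$ with $[x]\le[m]$), such that $[0]\in \mathrm{cl}_{\mathcal{T}}(\mathfrak{X})\setminus\mathfrak{X}$, and such that for every $[m_0]\in\mathfrak{X}$ there is a $\mathcal{T}$-neighborhood $U_0$ of $[0]$ with: if $[m]\in\mathfrak{X}$ and $[m]>[m_0]$, then $[m]\notin U_0$. *)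

(* Defs.v *)
From HB Require Import structures.
From mathcomp Require Import all_boot all_order all_algebra generic_quotient.
From mathcomp Require Import all_classical all_reals all_analysis.

Set Implicit Arguments.
Unset Strict Implicit.
Unset Printing Implicit Defensive.

Import Order.TTheory GRing.Theory Num.Theory.
Import numFieldNormedType.Exports.

Local Open Scope classical_set_scope.
Local Open Scope ring_scope.
Local Open Scope quotient_scope.

(* A function defined only on a neighborhood of 0 is represented by an
   arbitrary total extension: germ equality only sees values near 0. *)
Definition pointed_fun (R : realType) := {f : R -> R | f 0 == 0}.

Definition germ_eqv_prop (R : realType) (f g : pointed_fun R) : Prop :=
  \forall x \near (0 : R), val f x = val g x.

Definition germ_eqvb (R : realType) (f g : pointed_fun R) : bool :=
  `[< germ_eqv_prop f g >].

Lemma germ_eqvb_refl (R : realType) : reflexive (@germ_eqvb R).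
Proof.
by move=> f; apply/asboolP; near=> x.
Unshelve. all: by end_near. Qed.

Lemma germ_eqvb_sym (R : realType) : symmetric (@germ_eqvb R).
Proof.
move=> f g; apply/asboolP/asboolP; rewrite /germ_eqv_prop;
  by apply: filterS => x ->.
Qed.

Lemma germ_eqvb_trans (R : realType) : transitive (@germ_eqvb R).
Proof.
move=> g f h /asboolP fg /asboolP gh; apply/asboolP.
by apply: filterS2 fg gh => x -> ->.
Qed.

Canonical germ_eqv (R : realType) := EquivRel (@germ_eqvb R)
  (@germ_eqvb_refl R) (@germ_eqvb_sym R) (@germ_eqvb_trans R).

Definition germ (R : realType) := {eq_quot (germ_eqv R)}.
HB.instance Definition _ (R : realType) := Choice.on (germ R).
HB.instance Definition _ (R : realType) := EqQuotient.on (germ R).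

Definition germ_of (R : realType) (f : pointed_fun R) : germ R :=
  \pi_(germ R) f.

Lemma germ_ofP (R : realType) (f g : pointed_fun R) :
  germ_of f = germ_of g <-> \forall x \near (0 : R), val f x = val g x.
Proof. by split=> [/eqquotP/asboolP|fg]; [|apply/eqquotP/asboolP]. Qed.

Definition germ0 (R : realType) : germ R := germ_of (Sub (fun=> 0) (eqxx 0)).

(* The inequalities are on small t > 0 only, and are meant for germs in
   [Mtilde] below.  They do not depend on the representatives, see
   [germ_lt_of] and [germ_le_of]. *)
Definition germ_lt (R : realType) (x y : germ R) : Prop :=
  \forall t \near (0 : R)^'+, val (repr x) t < val (repr y) t.

Definition germ_le (R : realType) (x y : germ R) : Prop :=
  \forall t \near (0 : R)^'+, val (repr x) t <= val (repr y) t.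

Lemma repr_germ_of (R : realType) (f : pointed_fun R) :
  \forall t \near (0 : R)^'+, val (repr (germ_of f)) t = val f t.
Proof. by apply: cvg_within; apply/germ_ofP; rewrite /germ_of reprK. Qed.

Lemma germ_lt_of (R : realType) (f g : pointed_fun R) :
  germ_lt (germ_of f) (germ_of g) <->
  \forall t \near (0 : R)^'+, val f t < val g t.
Proof.
split; apply: filterS3 (repr_germ_of f) (repr_germ_of g) => t -> -> //.
Qed.

Lemma germ_le_of (R : realType) (f g : pointed_fun R) :
  germ_le (germ_of f) (germ_of g) <->
  \forall t \near (0 : R)^'+, val f t <= val g t.
Proof.
split; apply: filterS3 (repr_germ_of f) (repr_germ_of g) => t -> -> //.
Qed.

(* A function (0,oo) -> (0,oo) is a function on R whose values outside
   (0,oo) are ignored. *)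
Definition gauge (R : realType) (m : R -> R) : Prop :=
  [/\ forall t, 0 < t -> 0 < m t,
      exists2 d, 0 < d & forall r s, 0 < r -> r < s -> s < d -> m r <= m s
    & m t @[t --> (0 : R)^'+] --> (0 : R)].

Definition even_ext_fun (R : realType) (m : R -> R) (x : R) : R :=
  if x == 0 then 0 else m `|x|.

Lemma even_ext_fun0 (R : realType) (m : R -> R) : even_ext_fun m 0 == 0.
Proof. by rewrite /even_ext_fun eqxx. Qed.

Definition even_ext (R : realType) (m : R -> R) : pointed_fun R :=
  Sub (even_ext_fun m) (even_ext_fun0 m).

Definition Mtilde (R : realType) : set (germ R) :=
  [set x | exists2 m : R -> R, gauge m & x = germ_of (even_ext m)].

(* The class of [topologicalType] structures with carrier [T].  It also bundles
   equality and choice operators, which play no role in the topology. *)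
Definition topology_on (T : Type) := Topological.axioms_ T.

Definition space_of (T : Type) (tau : topology_on T) : topologicalType :=
  Topological.Pack tau.

Definition first_countable (T : topologicalType) : Prop :=
  forall x : T, exists B : set (set T),
    [/\ countable B, B `<=` nbhs x
      & forall A, nbhs x A -> exists2 U, B U & U `<=` A].

Definition germwise_coinitial (R : realType) (X : set (germ R)) : Prop :=
  forall m, Mtilde m -> exists2 x, X x & germ_le x m.

Definition asymptotically_compatible (R : realType)
    (tau : topology_on (germ R)) : Prop :=
  exists X : set (germ R),
    [/\ X `<=` @Mtilde R,
        germwise_coinitial X,
        (@closure (space_of tau) X `\` X) (germ0 R)
      & forall m0, X m0 ->
          exists2 U0 : set (germ R), @nbhs _ (space_of tau) (germ0 R) U0
            & forall m, X m -> germ_lt m0 m -> ~ U0 m].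

(* Main.v *)
Require Import Defs.
From mathcomp Require Import all_boot all_order all_algebra.
From mathcomp Require Import all_classical all_reals all_analysis.

(** The reason is that [Mtilde] has no countable coinitial family: any sequence
    of gauges lies strictly above a single gauge near 0
    ([gauge_below_sequence], a diagonal argument in the style of du
    Bois-Reymond).  Suppose that the zero germ had a countable neighborhood
    base.  As the zero germ is in the closure of the witness set X, each basic
    neighborhood meets X; choosing a point in each gives a sequence [x_ n] in
    X.  Take a gauge strictly below all the [x_ n], then by coinitiality an
    element m0 of X below that gauge.  The neighborhood U0 that compatibility
    attaches to m0 contains none of the [x_ n], yet it contains a basic
    neighborhood and hence the point chosen in it, a contradiction. *)

Set Implicit Arguments.
Unset Strict Implicit.
Unset Printing Implicit Defensive.

Import Order.TTheory GRing.Theory Num.Theory.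
Import numFieldNormedType.Exports.

Local Open Scope classical_set_scope.
Local Open Scope ring_scope.

Lemma germ_le_lt_trans (R : realType) (x y z : germ R) :
  germ_le x y -> germ_lt y z -> germ_lt x z.
Proof. by apply: filterS2 => t; exact: le_lt_trans. Qed.

Lemma even_ext_lt (R : realType) (m m' : R -> R) :
  (\forall t \near (0 : R)^'+, m t < m' t) ->
  germ_lt (germ_of (even_ext m)) (germ_of (even_ext m')).
Proof.
move=> mm'; apply/germ_lt_of; near=> t.
have t0 : 0 < t by near: t; exact: nbhs_right_gt.
rewrite /= /even_ext_fun gt_eqF// gtr0_norm//.
by near: t.
Unshelve. all: by end_near. Qed.

(** A window [0 < t < b] on which the gauge is monotone and below 2, so that
    half of it stays below 1; the bound c lets the windows of a sequence of
    gauges shrink to 0. *)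
Lemma gauge_window (R : realType) (m : R -> R) (c : R) : gauge m -> 0 < c ->
  exists b, [/\ 0 < b, b <= c,
    forall r s, 0 < r -> r <= s -> s < b -> m r <= m s
    & forall s, 0 < s -> s < b -> m s / 2 <= 1].
Proof.
move=> [_ [d d0 md] mcvg] c0.
have [e /= e0 me] : \forall t \near (0 : R)^'+, m t < 2.
  exact: (cvgr_lt _ mcvg).
exists (Num.min c (Num.min d e)); split.
- by rewrite !lt_min c0 d0 e0.
- by rewrite ge_min lexx.
- move=> r s r0 rs; rewrite !lt_min => /and3P[_ sd _].
  by move: rs; rewrite le_eqVlt => /predU1P[->//|rs]; exact: md.
- move=> s s0; rewrite !lt_min => /and3P[_ _ se].
  rewrite ler_pdivrMr// mul1r ltW// me//=.
  by rewrite sub0r normrN gtr0_norm.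
Qed.

(** The sequence is turned into the family [g n], equal to half of [m_ n] in
    the window [0 < t < b n] and to 1 beyond it.  Each [g n] is nondecreasing
    on the whole half-line, and as [b n] tends to 0, at each t all but finitely
    many [g n] equal 1: so the pointwise infimum stays positive, inherits
    monotonicity from the [g n], and is below half of [m_ n] in the n-th
    window. *)
Lemma gauge_below_sequence (R : realType) (m_ : nat -> R -> R) :
  (forall n, gauge (m_ n)) ->
  exists2 m, gauge m & forall n, \forall t \near (0 : R)^'+, m t < m_ n t.
Proof.
move=> mG.
have m_gt0 n t : 0 < t -> 0 < m_ n t by have [+ _ _] := mG n; exact.
have /choice[b bP] n := gauge_window (mG n)
  (ltac:(by rewrite invr_gt0 ltr0n) : 0 < n.+1%:R^-1 :> R).
pose g n t := if t < b n then m_ n t / 2 else 1.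
have g_gt0 n t : 0 < t -> 0 < g n t.
  by move=> t0; rewrite /g; case: ifP => // _; rewrite divr_gt0// m_gt0.
have g_mono n r s : 0 < r -> r <= s -> g n r <= g n s.
  have [_ _ mono le1] := bP n; move=> r0 rs; rewrite /g.
  have [sb|_] := ltP s (b n).
    by rewrite (le_lt_trans rs sb) ler_pM2r ?invr_gt0// mono.
  by case: ifP => // rb; exact: le1.
have g_bound t : 0 < t -> exists2 e, 0 < e & forall n, e <= g n t.
  move=> t0; have [N] := ltr_add_invr t0; rewrite add0r => Nt.
  have [e [e0 e1 eg]] : exists e, [/\ 0 < e, e <= 1 &
      forall n, (n < N)%N -> e <= g n t].
    elim: (N) => [|k [e [e0 e1 eg]]]; first by exists 1.
    exists (Num.min e (g k t)); split=> [||n].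
    - by rewrite lt_min e0 g_gt0.
    - by rewrite ge_min e1.
    - rewrite ltnS leq_eqVlt => /predU1P[->|nk]; first by rewrite ge_min lexx orbT.
      by rewrite ge_min eg.
  exists e => // n; have [/eg//|Nn] := ltnP n N.
  have [_ bn _ _] := bP n.
  rewrite /g ltNge (le_trans bn)//= (le_trans _ (ltW Nt))//.
  by rewrite lef_pV2 ?posrE ?ltr0n// ler_nat.
pose m t := inf (range (g ^~ t)).
have m_le t n : 0 < t -> m t <= g n t.
  move=> /g_bound[e _ eg]; apply: ge_inf; last by exists n.
  by exists e => _ [k _ <-].
have le_m t x : (forall n, x <= g n t) -> x <= m t.
  move=> xg; apply: lb_le_inf; first by exists (g 0%N t), 0%N.
  by move=> _ [k _ <-].
have m_pos t : 0 < t -> 0 < m t.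
  by move=> /g_bound[e e0 /le_m]; exact: lt_le_trans.
have m_half n : \forall t \near (0 : R)^'+, m t <= m_ n t / 2.
  have [bn0 _ _ _] := bP n; near=> t.
  have t0 : 0 < t by near: t; exact: nbhs_right_gt.
  have tb : t < b n by near: t; exact: nbhs_right_lt.
  by have := m_le t n t0; rewrite /g tb.
exists m => [|n]; last first.
  near=> t.
  have t0 : 0 < t by near: t; exact: nbhs_right_gt.
  have /le_lt_trans-> // : m t <= m_ n t / 2 by near: t; exact: m_half.
  by rewrite ltr_pdivrMr// ltr_pMr ?m_gt0// ltr1n.
split=> //.
  exists 1 => // r s r0 rs _; apply: le_m => n.
  by rewrite (le_trans (m_le _ n r0))// g_mono// ltW.
apply: (@squeeze_cvgr _ _ _ _ (fun=> 0) (fun t => m_ 0%N t / 2)).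
- near=> t.
  have t0 : 0 < t by near: t; exact: nbhs_right_gt.
  by rewrite ltW ?m_pos//=; near: t; exact: m_half.
- exact: cvg_cst.
- rewrite -[X in _ --> X](mul0r 2^-1); apply: cvgMl.
  by have [] := mG 0%N.
Unshelve. all: by end_near. Qed.

Lemma germ_below_sequence (R : realType) (X : set (germ R))
    (x_ : nat -> germ R) :
  germwise_coinitial X -> (forall n, Mtilde (x_ n)) ->
  exists2 m0, X m0 & forall n, germ_lt m0 (x_ n).
Proof.
move=> Xcoinit xM.
have /choice[m_ mP] n : exists m : R -> R, gauge m /\ x_ n = germ_of (even_ext m).
  by have [m] := xM n; exists m.
have [|m mG mlt] := @gauge_below_sequence R m_; first by move=> n; case: (mP n).
have [m0 Xm0 m0m] : exists2 x, X x & germ_le x (germ_of (even_ext m)).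
  by apply: Xcoinit; exists m.
exists m0 => // n; have [_ ->] := mP n.
exact/(germ_le_lt_trans m0m)/even_ext_lt/mlt.
Qed.

Theorem theorem3p3 (R : realType) (tau : topology_on (germ R)) :
  asymptotically_compatible tau -> ~ first_countable (space_of tau).
Proof.
move=> [X [XM Xcoinit [cl0 _] Xsep]] /(_ (germ0 R))[B [Bcount Bnbhs Bbase]].
have [code code_inj] := countable_injP _ Bcount.
(* The index set of the chosen points is made total: a number that is not the
   code of a basic neighborhood gets any point of X. *)
have /choice[x_ xP] n : exists x, X x /\ forall U, B U -> code U = n -> U x.
  have [[U [BU Un]]|noU] := pselect (exists U, B U /\ code U = n).
    have [x [Xx Ux]] := cl0 _ (Bnbhs _ BU).
    exists x; split=> // V BV Vn.
    by rewrite (code_inj V U) ?inE// Vn.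
  have [x [Xx _]] := cl0 _ filterT.
  by exists x; split=> // U BU Un; case: noU; exists U.
have [||m0 Xm0 m0x] := @germ_below_sequence R X x_ => //.
  by move=> n; apply: XM; have [] := xP n.
have [U0 /Bbase[U BU UU0] U0P] := Xsep _ Xm0.
have [Xx /(_ U BU erefl) Ux] := xP (code U).
exact: (U0P _ Xx (m0x _) (UU0 _ Ux)).
Qed.
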